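(* Consider an ensemble of $K$ decision trees on $\mathbb{R}^d$, an input $x\in\mathbb{R}^d$ and $\epsilon\ge 0$. Let $G=(V,E)$ be the graph whose vertices are the leaves $i$ of all the trees with $B^i\cap\mathrm{Ball}(x,\epsilon)\neq\emptyset$, with an edge between two distinct vertices $i,j$ if and only if $B^i\cap B^j\neq\emptyset$. Then a tuple $C=(i^{(1)},\dots,i^{(K)})$ with $i^{(k)}\in S^{(k)}$ for all $k=1,\dots,K$ is valid if and only if the nodes $i^{(1)},\dots,i^{(K)}$ form a $K$-clique (maximum clique) in $G$.
   Context: A decision tree on $\mathbb{R}^d$ is a finite rooted binary tree in which each internal node $i$ has a left child, a right child and a feature-threshold pair $(t_i,\eta_i)\in\{1,\dots,d\}\times\mathbb{R}$. An input $x\in\mathbb{R}^d$ starts at the root and at internal node $i$ goes to the left child if $x_{t_i}\le\eta_i$ and to the right child otherwise, until it reaches a leaf. For each node $i$ the box $B^i=(l^i_1,r^i_1]\times\dots\times(l^i_d,r^i_d]$ is defined recursively: the root's box is all of $\mathbb{R}^d$ (all intervals equal to $(-\infty,\infty)$). If $p$ and $q$ are the left and right children of $i$, their boxes agree with $B^i$ in every coordinate $t\ne t_i$, and in coordinate $t_i$ the interval of $p$ is $(l^i_{t_i},\min\{r^i_{t_i},\eta_i\}]$ and the interval of $q$ is $(\max\{l^i_{t_i},\eta_i\},r^i_{t_i}]$ (an interval $(l,r]$ with $l\ge r$ is empty, and $(l,\infty]$ means $(l,\infty)$). The ensemble has $K$ trees; $S^{(k)}$ is the set of leaves of tree $k$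 (leaves of different trees are regarded as distinct), $m^{(k)}(x)\in S^{(k)}$ is the leaf of tree $k$ reached by $x$, and $\mathcal{C}(x)=(m^{(1)}(x),\dots,m^{(K)}(x))$. $\mathrm{Ball}(x,\epsilon)=\{x'\in\mathbb{R}^d:\|x'-x\|_\infty\le\epsilon\}$. A tuple $C=(i^{(1)},\dots,i^{(K)})$ is valid if and only if there exists $x'\in\mathrm{Ball}(x,\epsilon)$ such that $C=\mathcal{C}(x')$. A $K$-clique is a set of $K$ distinct, pairwise adjacent vertices of $G$; since no two leaves of the same tree are adjacent, $G$ is $K$-partite and a clique has at most $K$ vertices. *)

(* Defs.v *)
From HB Require Import structures.
From mathcomp Require Import all_boot all_order all_algebra.
From mathcomp Require Import all_classical all_reals all_analysis.
Set Implicit Arguments.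
Unset Strict Implicit.
Unset Printing Implicit Defensive.
Import Order.TTheory GRing.Theory Num.Theory.
Import numFieldNormedType.Exports.
Local Open Scope classical_set_scope.
Local Open Scope ring_scope.

Inductive dtree (R : realType) (d : nat) : Type :=
| Leaf
| Node (t : 'I_d) (eta : R) (p q : dtree R d).

Arguments Leaf {R d}.

(* The leaves of a tree are its leaf positions: a leaf of [Node t eta p q] is
   either a leaf of [p] or a leaf of [q]. *)
Fixpoint leaf (R : realType) (d : nat) (T : dtree R d) : finType :=
  match T with
  | Leaf => unit
  | Node _ _ p q => (leaf p + leaf q)%type
  end.

Fixpoint reach (R : realType) (d : nat) (T : dtree R d) (x : 'rV[R]_d) :
    leaf T :=
  match T return leaf T with
  | Leaf => tt
  | Node t eta p q =>
      if x ord0 t <= eta then inl (reach p x) else inr (reach q x)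
  end.

(* The box (lo_1, hi_1] x ... x (lo_d, hi_d], with extended real endpoints. *)
Record box (R : realType) (d : nat) :=
  Box { lo : 'I_d -> \bar R; hi : 'I_d -> \bar R }.

(* Points have finite coordinates, so (l, +oo] denotes (l, +oo) and the box is
   empty as soon as some lo_t >= hi_t. *)
Definition box_set (R : realType) (d : nat) (B : box R d) : set 'rV[R]_d :=
  [set x | forall t, (lo B t < (x ord0 t)%:E <= hi B t)%E].

Definition full_box (R : realType) (d : nat) : box R d :=
  Box (fun=> -oo%E) (fun=> +oo%E).

Definition left_box (R : realType) (d : nat) (B : box R d) (t : 'I_d)
    (eta : R) : box R d :=
  Box (lo B)
      (fun s => if s == t then Order.min (hi B s) eta%:E else hi B s).

Definition right_box (R : realType) (d : nat) (B : box R d) (t : 'I_d)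
    (eta : R) : box R d :=
  Box (fun s => if s == t then Order.max (lo B s) eta%:E else lo B s)
      (hi B).

(* The box of leaf [i] when the root of [T] has box [B]. *)
Fixpoint box_from (R : realType) (d : nat) (B : box R d) (T : dtree R d) :
    leaf T -> box R d :=
  match T return leaf T -> box R d with
  | Leaf => fun=> B
  | Node t eta p q => fun i =>
      match i with
      | inl j => box_from (left_box B t eta) j
      | inr j => box_from (right_box B t eta) j
      end
  end.

Definition leaf_box (R : realType) (d : nat) (T : dtree R d) (i : leaf T) :
    set 'rV[R]_d :=
  box_set (box_from (full_box R d) i).

(* The norm on ['rV[R]_d] is the sup norm. *)
Definition Ball (R : realType) (d : nat) (x : 'rV[R]_d) (eps : R) :
    set 'rV[R]_d :=
  [set x' | `|x' - x| <= eps].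

Record graph (V : finType) := Graph {
  vertices : {set V};
  adj : rel V;
  adj_vertices : forall i j, adj i j -> (i \in vertices) && (j \in vertices);
  adj_sym : symmetric adj;
  adj_irrefl : irreflexive adj }.

Definition clique (V : finType) (G : graph V) (A : {set V}) : Prop :=
  A \subset vertices G /\
  (forall i j, i \in A -> j \in A -> i != j -> adj G i j).

Definition kclique (V : finType) (G : graph V) (k : nat) (A : {set V}) :
    Prop :=
  clique G A /\ #|A| = k.

Definition maximum_clique (V : finType) (G : graph V) (A : {set V}) : Prop :=
  clique G A /\ (forall B : {set V}, clique G B -> (#|B| <= #|A|)%N).

Definition ensemble (R : realType) (d K : nat) := 'I_K -> dtree R d.

Section Ensemble.
Variables (R : realType) (d K : nat) (F : ensemble R d K).

(* All leaves of the ensemble; leaves of different trees are distinct. *)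
Definition ens_leaf : finType := {k : 'I_K & leaf (F k)}.

Definition ens_box (i : ens_leaf) : set 'rV[R]_d := leaf_box (tagged i).

Definition leaf_tuple := forall k : 'I_K, leaf (F k).

Definition ens_reach (x : 'rV[R]_d) : leaf_tuple := fun k => reach (F k) x.

Definition valid (x : 'rV[R]_d) (eps : R) (C : leaf_tuple) : Prop :=
  exists2 x', Ball x eps x' & C = ens_reach x'.

Definition tuple_leaves (C : leaf_tuple) : {set ens_leaf} :=
  [set (Tagged (fun k => leaf (F k)) (C k) : ens_leaf) | k : 'I_K]%SET.

Variables (x : 'rV[R]_d) (eps : R).

Definition ens_vertices : {set ens_leaf} :=
  [set i : ens_leaf | `[< ens_box i `&` Ball x eps !=set0 >]]%SET.

Definition ens_adj : rel ens_leaf := fun i j =>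
  [&& i \in ens_vertices, j \in ens_vertices, i != j
    & `[< ens_box i `&` ens_box j !=set0 >]].

Lemma ens_adj_vertices i j :
  ens_adj i j -> (i \in ens_vertices) && (j \in ens_vertices).
Proof. by case/and4P=> -> ->. Qed.

Lemma ens_adj_sym : symmetric ens_adj.
Proof. by move=> i j; rewrite /ens_adj andbCA eq_sym setIC. Qed.

Lemma ens_adj_irrefl : irreflexive ens_adj.
Proof. by move=> i; rewrite /ens_adj eqxx !andbF. Qed.

Definition ens_graph : graph ens_leaf :=
  Graph ens_adj_vertices ens_adj_sym ens_adj_irrefl.

End Ensemble.

(* Main.v *)
(** The leaf boxes of a tree partition the space, and [C] is the tuple reached
    by [x'] iff [x'] lies in the box of every leaf of [C].  So distinct leaves
    of one tree are never adjacent, and the converse direction is Helly's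
    theorem for axis-parallel boxes: coordinatewise, the least of the right
    endpoints of pairwise intersecting intervals lies in all of them.  The
    ball is itself a box, closed on the left. *)
Require Import Defs.
From HB Require Import structures.
From mathcomp Require Import all_boot all_order all_algebra.
From mathcomp Require Import all_classical all_reals all_analysis.
Import Order.TTheory GRing.Theory Num.Theory.
Import numFieldNormedType.Exports.
Local Open Scope ring_scope.

Lemma box_set_left (R : realType) (d : nat) (B : box R d) (t : 'I_d) (eta : R)
    (y : 'rV[R]_d) :
  box_set (left_box B t eta) y <-> box_set B y /\ y ord0 t <= eta.
Proof.
split=> [By | [By yt] s].
- split=> [s|].
    have /andP[ly yh] := By s; rewrite ly /=.
    by move: yh; rewrite /=; case: ifP => // _; rewrite le_min => /andP[].
  by have /andP[_] := By t; rewrite /= eqxx le_min lee_fin => /andP[].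
have /andP[ly yh] := By s; rewrite /= ly /=.
by case: eqP => // ->{s By ly} in yh *; rewrite le_min yh lee_fin.
Qed.

Lemma box_set_right (R : realType) (d : nat) (B : box R d) (t : 'I_d) (eta : R)
    (y : 'rV[R]_d) :
  box_set (right_box B t eta) y <-> box_set B y /\ eta < y ord0 t.
Proof.
split=> [By | [By yt] s].
- split=> [s|].
    have /andP[ly yh] := By s; rewrite yh andbT.
    by move: ly; rewrite /=; case: ifP => // _; rewrite gt_max => /andP[].
  by have /andP[+ _] := By t; rewrite /= eqxx gt_max lte_fin => /andP[].
have /andP[ly yh] := By s; rewrite /= yh andbT.
by case: eqP => // ->{s By yh} in ly *; rewrite gt_max ly lte_fin.
Qed.

(** The root box [B] is arbitrary because it shrinks at each descent in the induction on [T]; each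
    split adds to the box exactly the threshold test that [reach] performs. *)
Lemma box_from_reach (R : realType) (d : nat) (T : dtree R d) (B : box R d)
    (i : leaf T) (y : 'rV[R]_d) :
  box_set (box_from B i) y <-> box_set B y /\ reach T y = i.
Proof.
elim: T B i => [|t eta p IHp q IHq] B /=; first by case; split=> [|[]].
case=> j.
- rewrite IHp box_set_left; case: ifP => yt; split.
  + by move=> [[By _] <-].
  + by move=> [By [<-]].
  + by move=> [[]].
  + by move=> [].
- rewrite IHq box_set_right; case: ifP => yt; split.
  + by move=> [[_]]; rewrite ltNge yt.
  + by move=> [].
  + by move=> [[By _] <-].
  + by move=> [By [<-]]; rewrite ltNge yt.
Qed.

Lemma leaf_boxE (R : realType) (d : nat) (T : dtree R d) (i : leaf T)
    (y : 'rV[R]_d) :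
  leaf_box i y <-> reach T y = i.
Proof.
rewrite /leaf_box box_from_reach; split=> [[]//|<-]; split=> // t.
by rewrite /= ltNyr leey.
Qed.

(** Coordinatewise form of the sup-norm ball, which lets it join the Helly argument as one more
    product of intervals. *)
Lemma BallP (R : realType) (d : nat) (x y : 'rV[R]_d) (eps : R) :
  0 <= eps ->
  Ball x eps y <-> forall t, x ord0 t - eps <= y ord0 t <= x ord0 t + eps.
Proof.
move=> eps_ge0; rewrite /Ball /= /Num.norm /= mx_normrE; split=> [|xy].
- move=> /bigmax_leP[_ xy] t; have := xy (ord0, t) isT.
  by rewrite !mxE ler_distl.
(* The maximum defining the norm starts from 0, so its bound also requires [0 <= eps]. *)
- apply/bigmax_leP; split=> // -[i t] _.
  by rewrite !mxE ler_distl ord1 xy.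
Qed.

Lemma box_helly (R : realType) (d : nat) (I : finType) (B : I -> box R d)
    (x : 'rV[R]_d) (eps : R) :
  0 <= eps ->
  (forall k, (box_set (B k) `&` Ball x eps !=set0)%classic) ->
  (forall k l, (box_set (B k) `&` box_set (B l) !=set0)%classic) ->
  exists2 y, Ball x eps y & forall k, box_set (B k) y.
Proof.
move=> eps_ge0 Bx BB.
(* The coordinates of the common point. Starting the minimum at the right end of the ball accounts
   for the ball and keeps [m t] below [+oo] even when every [hi (B k) t] is infinite. *)
pose m t : \bar R := \big[Order.min/(x ord0 t + eps)%:E]_k hi (B k) t.
(* Each box meets the ball, so no right endpoint lies left of the ball. *)
have m_ge t : ((x ord0 t - eps)%:E <= m t)%E.
  apply/bigmin_geP; split=> [|k _].
    by rewrite lee_fin lerD2l ge0_cp.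
  have [y [By /BallP -/(_ eps_ge0 t)/andP[xy _]]] := Bx k.
  by have /andP[_] := By t; apply: le_trans; rewrite lee_fin.
have m_le t : (m t <= (x ord0 t + eps)%:E)%E by exact: bigmin_le_id.
have m_fin t : m t \is a fin_num.
  by rewrite fin_numElt (lt_le_trans (ltNyr _) (m_ge t))
    (le_lt_trans (m_le t) (ltry _)).
exists (\row_t fine (m t)).
  apply/BallP => // t; rewrite mxE -!lee_fin fineK //.
  by rewrite m_ge m_le.
move=> k t; rewrite mxE fineK //; apply/andP; split; last exact: bigmin_le.
(* [lo (B k) t] is strictly below every term of the minimum: a common point of box [k] with the
   ball, or with box [l], separates the two. *)
apply/bigmin_gtP; split=> [|l _].
  have [y [By /BallP -/(_ eps_ge0 t)/andP[_ yx]]] := Bx k.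
  by have /andP[ly _] := By t; apply: lt_le_trans ly _; rewrite lee_fin.
have [y [/(_ t)/andP[ly _] /(_ t)/andP[_ yh]]] := BB k l.
exact: lt_le_trans ly yh.
Qed.

Lemma card_tuple_leaves (R : realType) (d K : nat) (F : ensemble R d K)
    (C : leaf_tuple F) : #|tuple_leaves C| = K.
Proof.
rewrite card_imset ?card_ord // => k l /(congr1 tag); exact.
Qed.

(** [tag] is injective on a clique: two distinct leaves of one tree would be adjacent, and a point
    common to their boxes would reach both. *)
Lemma ens_clique_card (R : realType) (d K : nat) (F : ensemble R d K)
    (x : 'rV[R]_d) (eps : R) (A : {set ens_leaf F}) :
  clique (ens_graph F x eps) A -> (#|A| <= K)%N.
Proof.
move=> [_ adjA]; rewrite -[leqRHS]card_ord -(@card_in_imset _ _ tag A).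
  exact: max_card.
move=> [k i] [l j] iA jA /= kl; subst l.
have [//|ij] := eqVneq (existT _ k i : ens_leaf F) (existT _ k j).
have /and4P[_ _ _ /asboolP[y [/leaf_boxE yi /leaf_boxE yj]]] := adjA _ _ iA jA ij.
by move: yi yj => /= <- <-.
Qed.

(** From left to right, the single point reaching [C] witnesses all vertices and all edges; the
    converse is [box_helly]. *)
Lemma valid_clique (R : realType) (d K : nat) (F : ensemble R d K)
    (x : 'rV[R]_d) (eps : R) (eps_ge0 : 0 <= eps) (C : leaf_tuple F) :
  valid x eps C <-> clique (ens_graph F x eps) (tuple_leaves C).
Proof.
split=> [[y xy CE]|[CV CA]].
- have yC k : leaf_box (C k) y by apply/leaf_boxE; rewrite CE.
  have VC k : (Tagged (fun k => leaf (F k)) (C k) : ens_leaf F)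
      \in ens_vertices F x eps.
    by rewrite inE; apply/asboolP; exists y; split=> //; exact: yC.
  split=> [|_ _ /imsetP[k _ ->] /imsetP[l _ ->] kl].
    by apply/fintype.subsetP => _ /imsetP[k _ ->]; exact: VC.
  apply/and4P; split=> //.
  by apply/asboolP; exists y; split; exact: yC.
- have Cx k : (leaf_box (C k) `&` Ball x eps !=set0)%classic.
    have /(fintype.subsetP CV) : Tagged (fun k => leaf (F k)) (C k) \in tuple_leaves C.
      exact: imset_f.
    by rewrite inE => /asboolP.
  have CC k l : (leaf_box (C k) `&` leaf_box (C l) !=set0)%classic.
    (* The graph has no loops, so for [k = l] nonemptiness comes from the vertex condition. *)
    have [<-|kl] := eqVneq k l.
      by have [y [yk _]] := Cx k; exists y.
    have := CA (Tagged (fun k => leaf (F k)) (C k))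
      (Tagged (fun k => leaf (F k)) (C l)) (imset_f _ isT) (imset_f _ isT).
    case/(_ _)/and4P; last by move=> _ _ _ /asboolP.
    by apply: contraNneq kl => /(congr1 tag) /= ->.
  have [y xy yC] := box_helly _ _ _ _ _ _ eps_ge0 Cx CC.
  exists y => //; apply: functional_extensionality_dep => k.
  by apply/esym/leaf_boxE; exact: yC.
Qed.

Theorem lemma2 (R : realType) (d K : nat) (F : ensemble R d K)
    (x : 'rV[R]_d) (eps : R) (eps_ge0 : 0 <= eps) (C : leaf_tuple F) :
  (valid x eps C <-> kclique (ens_graph F x eps) K (tuple_leaves C)) /\
  (kclique (ens_graph F x eps) K (tuple_leaves C) <->
     maximum_clique (ens_graph F x eps) (tuple_leaves C)).
Proof.
(* With the size of the tuple rewritten to [K], all three conditions reduce to being a clique;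
   maximality is then the bound [ens_clique_card]. *)
rewrite /kclique /maximum_clique card_tuple_leaves (valid_clique _ _ _ _ _ _ eps_ge0).
split; split=> [cC|[]//]; first by [].
by split=> [|A /ens_clique_card]; first case: cC.
Qed.
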